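(* Let $D$ be a weighted oriented graph and let $D'$ be the weighted oriented graph obtained from $D$ by replacing the weights of all sink vertices of $D$ by $1$. Then $I_D=I_{D'}$. Moreover, the generators of $I_D$ are independent of the weights of the sink vertices of $D$: if $D''$ is any weighted oriented graph with the same vertices and the same oriented edges as $D$ and with the same weights as $D$ at all non-sink vertices, then $I_D=I_{D''}$.
   Context: $K$ is a field. A weighted oriented graph $D=(V(D),E(D),\mathbf w)$ is a finite graph without loops or parallel edges on $V(D)=\{x_1,\dots,x_n\}$, each edge being given an orientation ($(x_i,x_j)$ denotes an edge from $x_i$ to $x_j$), together with a weight function $\mathbf w:V(D)\to\{1,2,\dots\}$; put $w_i=\mathbf w(x_i)$. Write $E(D)=\{e_1,\dots,e_m\}$. The toric ideal $I_D$ is the kernel of the $K$-algebra homomorphism $K[e_1,\dots,e_m]\to K[x_1,\dots,x_n]$ sending $e_j=(x_i,x_l)$ to $x_ix_l^{w_l}$. A vertex $v$ is a sink if its outdegree is zero, i.e. no edge of $D$ has the form $(v,v')$. *)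

(* Defs.v *)
From HB Require Import structures.
From mathcomp Require Import all_boot all_order all_algebra.
From mathcomp Require Import mpoly.

Set Implicit Arguments.
Unset Strict Implicit.
Unset Printing Implicit Defensive.

Import GRing.Theory.
Local Open Scope ring_scope.

(* The edges are listed as e_0, ..., e_(m-1), so that toric ideals of graphs
   with the same listed edges live in the same ring {mpoly K[m]}.  The pair
   (i, l) is the edge oriented from i to l; since wog_simple compares the
   unordered pairs of endpoints, it also excludes having both (i, l) and
   (l, i). *)
Record wograph (n m : nat) := WOGraph {
  edge : 'I_m -> 'I_n * 'I_n;
  weight : 'I_n -> nat;
  wog_loopless : forall j, (edge j).1 != (edge j).2;
  wog_simple : injective (fun j => [set (edge j).1; (edge j).2]);
  weight_gt0 : forall v, (0 < weight v)%N
}.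

Definition sink n m (D : wograph n m) (v : 'I_n) : bool :=
  [forall j, (edge D j).1 != v].

Definition sink1_weight n m (D : wograph n m) (v : 'I_n) : nat :=
  if sink D v then 1%N else weight D v.

Lemma sink1_weight_gt0 n m (D : wograph n m) v : (0 < sink1_weight D v)%N.
Proof. by rewrite /sink1_weight; case: ifP => // _; exact: weight_gt0. Qed.

Definition reset_sinks n m (D : wograph n m) : wograph n m :=
  WOGraph (@wog_loopless _ _ D) (@wog_simple _ _ D) (sink1_weight_gt0 D).

Definition edge_monomial (K : fieldType) n m (D : wograph n m) (j : 'I_m) :
    {mpoly K[n]} :=
  'X_((edge D j).1) * 'X_((edge D j).2) ^+ weight D (edge D j).2.

Definition toric_map (K : fieldType) n m (D : wograph n m)
    (p : {mpoly K[m]}) : {mpoly K[n]} :=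
  p \mPo [tuple edge_monomial K D j | j < m].

Definition toric_ideal (K : fieldType) n m (D : wograph n m) :
    {pred {mpoly K[m]}} :=
  [pred p | toric_map D p == 0].
Arguments toric_ideal K {n m} D.

Lemma toric_mapX (K : fieldType) n m (D : wograph n m) (j : 'I_m) :
  toric_map D ('X_j : {mpoly K[m]}) = edge_monomial K D j.
Proof. by rewrite /toric_map comp_mpolyXU -tnth_nth tnth_mktuple. Qed.

(* Main.v *)
(* With D' the graph with all sink weights reset to 1, the substitution
   x_v -> x_v ^ w_v at the sinks v, x_v -> x_v elsewhere, maps the edge
   monomials of D' to those of D, because the tail of an edge is never a sink.
   It is an injective endomorphism of K[x_1, ..., x_n], so the toric maps of D
   and D' have the same kernel.  The second claim follows since D'' resets to
   the same graph. *)
Require Import Defs.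
From mathcomp Require Import all_boot all_order all_algebra.
From mathcomp Require Import mpoly.

Import GRing.Theory.
Local Open Scope ring_scope.

Definition power_subst (K : fieldType) (n : nat) (a : 'I_n -> nat)
    (p : {mpoly K[n]}) : {mpoly K[n]} :=
  p \mPo [tuple 'X_i ^+ a i | i < n].

(** The substitution sends the monomial of exponent [v] to that of exponent [a * v], and
    [v -> a * v] is injective for positive [a]; hence only the term of [p] at [u] contributes. *)
Lemma mcoeff_power_subst (K : fieldType) (n : nat) (a : 'I_n -> nat)
    (p : {mpoly K[n]}) (u : 'X_{1..n}) :
  (forall i, 0 < a i)%N ->
  (power_subst K n a p)@_[multinom (a i * u i)%N | i < n] = p@_u.
Proof.
move=> a_gt0; rewrite /power_subst comp_mpolyEX [in RHS](mpolyE p) !raddf_sum /=.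
apply: eq_bigr => v _; rewrite !mcoeffZ; congr (_ * _).
have -> : 'X_[v] \mPo [tuple 'X_i ^+ a i | i < n]
          = 'X_[[multinom (a i * v i)%N | i < n]] :> {mpoly K[n]}.
  rewrite comp_mpolyX mpolyXE_id; apply: eq_bigr => i _.
  by rewrite tnth_mktuple -exprM mnmE.
rewrite !mcoeffX; congr ((_ : bool)%:R).
(* Injectivity on exponents: cancel [a i > 0] in each coordinate. *)
apply/eqP/eqP => [/mnmP eq_av | -> //]; apply/mnmP => i.
by apply/eqP; have /eqP := eq_av i; rewrite !mnmE eqn_pmul2l.
Qed.

Lemma power_subst_eq0 (K : fieldType) (n : nat) (a : 'I_n -> nat)
    (p : {mpoly K[n]}) :
  (forall i, 0 < a i)%N -> (power_subst K n a p == 0) = (p == 0).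
Proof.
move=> a_gt0; apply/eqP/eqP => [p0 | ->]; last exact: comp_mpoly0.
by apply/mpolyP => u; rewrite -(mcoeff_power_subst K n a) // p0 !mcoeff0.
Qed.

(** Complement of [sink1_weight]: at each vertex the product of the two is the weight in [D]. *)
Definition sink_weight (n m : nat) (D : wograph n m) (v : 'I_n) : nat :=
  if sink D v then weight D v else 1%N.

Lemma sink_weight_gt0 (n m : nat) (D : wograph n m) (v : 'I_n) :
  (0 < sink_weight n m D v)%N.
Proof. by rewrite /sink_weight; case: ifP => // _; exact: weight_gt0. Qed.

Lemma edge_tail_not_sink (n m : nat) (D : wograph n m) (j : 'I_m) :
  sink D (edge D j).1 = false.
Proof. by apply/negbTE/forallPn; exists j; rewrite negbK. Qed.

Lemma edge_monomial_reset_sinks (K : fieldType) (n m : nat) (D : wograph n m)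
    (j : 'I_m) :
  power_subst K n (sink_weight n m D) (edge_monomial K (reset_sinks D) j)
  = edge_monomial K D j.
Proof.
rewrite /power_subst /edge_monomial rmorphM rmorphXn /= !comp_mpolyXU.
rewrite -!tnth_nth !tnth_mktuple -exprM.
rewrite /sink_weight /sink1_weight edge_tail_not_sink expr1.
by case: ifP; rewrite ?muln1 ?mul1n.
Qed.

(** Both sides are algebra homomorphisms in [p] that agree on the variables. *)
Lemma toric_map_reset_sinks (K : fieldType) (n m : nat) (D : wograph n m)
    (p : {mpoly K[m]}) :
  power_subst K n (sink_weight n m D) (toric_map (reset_sinks D) p)
  = toric_map D p.
Proof.
rewrite /toric_map !comp_mpolyE [in LHS]/power_subst raddf_sum /=.
apply: eq_bigr => u _; rewrite linearZ rmorph_prod /=; congr (_ *: _).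
apply: eq_bigr => j _; rewrite rmorphXn /= !tnth_mktuple; congr (_ ^+ _).
exact: edge_monomial_reset_sinks.
Qed.

Lemma toric_ideal_reset_sinks (K : fieldType) (n m : nat) (D : wograph n m) :
  toric_ideal K D =i toric_ideal K (reset_sinks D).
Proof.
move=> p; rewrite !inE -toric_map_reset_sinks power_subst_eq0 //.
exact: sink_weight_gt0.
Qed.

(** Pointwise agreement is enough here, so the two graphs need not be equal as records. *)
Lemma eq_edge_monomial_toric_ideal (K : fieldType) (n m : nat)
    (D1 D2 : wograph n m) :
  edge_monomial K D1 =1 edge_monomial K D2 ->
  toric_ideal K D1 =i toric_ideal K D2.
Proof.
move=> eqD p; rewrite !inE /toric_map; congr (_ \mPo _ == 0).
by apply: eq_from_tnth => j; rewrite !tnth_mktuple.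
Qed.

Theorem proposition3p8 (K : fieldType) (n m : nat) (D : wograph n m) :
  toric_ideal K D =i toric_ideal K (reset_sinks D) /\
  (forall D'' : wograph n m,
     (forall j : 'I_m, edge D'' j = edge D j) ->
     (forall v : 'I_n, ~~ sink D v -> weight D'' v = weight D v) ->
     toric_ideal K D =i toric_ideal K D'').
Proof.
split=> [|D'' eq_edge eq_weight p]; first exact: toric_ideal_reset_sinks.
rewrite [LHS]toric_ideal_reset_sinks [RHS]toric_ideal_reset_sinks.
apply: eq_edge_monomial_toric_ideal => j.
rewrite /edge_monomial /= !eq_edge; congr (_ * _ ^+ _).
(* Being a sink depends only on the oriented edges. So both reset weights are 1 at the common sinks,
   and elsewhere [eq_weight] applies. *)
have eq_sink v : sink D'' v = sink D v.
  by apply: eq_forallb => i; rewrite eq_edge.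
by rewrite /sink1_weight eq_sink; case: ifPn => // /eq_weight ->.
Qed.
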